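(* Let $\mathbb{X}$ be a smooth real Banach space with $\dim(\mathbb{X}) \ge 3$. Then $\mathbb{X}$ is a Hilbert space (i.e. its norm is induced by an inner product) if and only if there does not exist any anti-coproximinal closed hyperspace in $\mathbb{X}$.
   Context: For nonzero $x \in \mathbb{X}$, $J(x) = \{f \in S_{\mathbb{X}^*} : f(x) = \|x\|\}$; $\mathbb{X}$ is smooth if $J(x)$ is a singleton for every $x$ in the unit sphere. A hyperspace is a linear subspace of codimension one. Given a subspace $\mathbb{Y}$ and $x \in \mathbb{X}$, an element $y_0 \in \mathbb{Y}$ is a best coapproximation to $x$ out of $\mathbb{Y}$ if $\|y_0 - y\| \le \|x - y\|$ for all $y \in \mathbb{Y}$. $\mathbb{Y}$ is anti-coproximinal in $\mathbb{X}$ if for every $x \in \mathbb{X} \setminus \mathbb{Y}$ there does not exist any best coapproximation to $x$ out of $\mathbb{Y}$. *)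

(* Defs.v *)
From HB Require Import structures.
From mathcomp Require Import all_boot all_order all_algebra.
From mathcomp Require Import all_classical all_reals all_analysis.

Set Implicit Arguments.
Unset Strict Implicit.
Unset Printing Implicit Defensive.

Import Order.TTheory GRing.Theory Num.Theory.
Import numFieldNormedType.Exports.

Local Open Scope classical_set_scope.
Local Open Scope ring_scope.

Section Definitions.
Context {R : realType} {X : normedModType R}.

Definition lin_indep (n : nat) (e : 'I_n -> X) : Prop :=
  forall c : 'I_n -> R, \sum_(i < n) c i *: e i = 0 -> forall i, c i = 0.

(* The supremum is that of a nonempty bounded set whenever f is linear and
   continuous; [op_norm] is only used for such f. *)
Definition op_norm (f : X -> R) : R :=
  sup [set `|f x| | x in [set x : X | `|x| <= 1]].

(* The topological dual X^* and its unit sphere are sets of plain functions,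
   so that equality of functionals is equality of functions. *)
Definition dual : set (X -> R) := [set f : X -> R | scalar f /\ continuous f].

Definition dual_sphere : set (X -> R) := [set f | dual f /\ op_norm f = 1].

Definition support_functionals (x : X) : set (X -> R) :=
  [set f | dual_sphere f /\ f x = `|x|].

Definition best_coapproximation (Y : set X) (x y0 : X) : Prop :=
  Y y0 /\ forall y, Y y -> `|y0 - y| <= `|x - y|.

Definition anti_coproximinal (Y : set X) : Prop :=
  forall x, ~ Y x -> ~ exists y0, best_coapproximation Y x y0.

(* Codimension one: the class of z is a basis of the quotient X / Y. *)
Definition hyperspace (Y : set X) : Prop :=
  submod_closed (mem Y) /\
  exists z : X, ~ Y z /\ forall x, exists a : R, Y (x - a *: z).

End Definitions.

Definition dim_ge {R : realType} (X : normedModType R) (n : nat) : Prop :=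
  exists e : 'I_n -> X, lin_indep e.

Definition smooth {R : realType} (X : normedModType R) : Prop :=
  forall x : X, `|x| = 1 -> exists f, support_functionals x = [set f].

(* [{dot X for idfun}] is the type of real inner products on X; completeness of
   the norm is part of [completeNormedModType]. *)
Definition hilbert {R : realType} (X : completeNormedModType R) : Prop :=
  exists d : {dot X for @idfun R}, forall x : X, `|x| = Num.sqrt (d x x).

(* Main.v *)
(* Let J x be the support functional at x scaled to norm one.  If ker g is not
   anti-coproximinal, it is the range of a norm-one projection along some
   vector v; since J w is unique, J w vanishes at v for all w in ker g, and v
   (a pole of g) is unique up to scaling.  For w in the codimension two space
   ker g ∩ ker h the functionals J w vanish on the poles of the whole pencil
   spanned by g and h, and g, h separate the vectors killed by all these J w.
   So the map from functionals to poles is a collineation between projective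
   spaces.  Two functionals cannot share a pole, because the set of functionals
   sharing it would be a bounded prism in every direction J w.  As dim X >= 3,
   the argument of the fundamental theorem of projective geometry yields a
   linear map T choosing a pole T g for each g.  Then J w (T g) = c(w) g(w), so
   J w / c(w) is linear in w: it is a bilinear form B with
   d|w| = |w| B(w, .) / B(w, w).  Along segments the logarithmic derivative of
   |w|^2 / B(w, w) has the sign of the constant B(x, y) - B(y, x); going from x
   to y to -x shows that this ratio is constant, so |.|^2 is a quadratic form.
   Conversely, in a Hilbert space the orthogonal projection onto a closed
   hyperspace is a best coapproximation. *)
Require Import Defs.
From HB Require Import structures.
From mathcomp Require Import all_boot all_order all_algebra.
From mathcomp Require Import all_classical all_reals all_analysis.
From mathcomp Require Import ring lra.

Set Implicit Arguments.
Unset Strict Implicit.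
Unset Printing Implicit Defensive.

Import Order.TTheory GRing.Theory Num.Theory.
Import numFieldNormedType.Exports.

Local Open Scope classical_set_scope.
Local Open Scope ring_scope.

(** * The topological dual and the duality map *)

Section TopologicalDual.
Context {R : realType} {X : normedModType R}.

Definition dual_pred : {pred X -> R} := fun g => `[< dual g >].

Lemma dual_submod_closed : submod_closed dual_pred.
Proof.
split.
  apply/asboolP; split; first by move=> a x y; rewrite mulr0 addr0.
  exact: cst_continuous.
move=> a g h /asboolP[lg cg] /asboolP[lh ch]; apply/asboolP; split.
  move=> b x y.
  have E z : (a *: g + h) z = a * g z + h z by [].
  by rewrite !E lg lh; ring.
move=> x; apply: cvgD; last exact: ch.
by apply: cvgZr; exact: cg.
Qed.

HB.instance Definition _ :=
  GRing.isSubmodClosed.Build R (X -> R) dual_pred dual_submod_closed.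

(** Bundled so that functionals form an [R]-module while still coercing to functions. *)
Record topdual :=
  Topdual { topdual_val :> X -> R ; topdual_valP : topdual_val \in dual_pred }.

HB.instance Definition _ := [isSub for topdual_val].
HB.instance Definition _ := [Choice of topdual by <:].
HB.instance Definition _ := [SubChoice_isSubLmodule of topdual by <:].

Implicit Types (g h : topdual) (a : R) (x y : X).

Lemma topdual_dual g : dual g.
Proof. by have /asboolP := topdual_valP g. Qed.

Lemma topdualP g h : g =1 h -> g = h.
Proof. by move=> gh; apply: val_inj; apply/funext. Qed.

Lemma topdual_fD g h x : (g + h) x = g x + h x. Proof. by []. Qed.
Lemma topdual_fN g x : (- g) x = - g x. Proof. by []. Qed.
Lemma topdual_fB g h x : (g - h) x = g x - h x. Proof. by []. Qed.
Lemma topdual_fZ a g x : (a *: g) x = a * g x. Proof. by []. Qed.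
Lemma topdual_f0 x : (0 : topdual) x = 0. Proof. by []. Qed.

Lemma topdualDZ g a x y : g (a *: x + y) = a * g x + g y.
Proof. by have [+ _] := topdual_dual g; exact. Qed.

Lemma topdualD g x y : g (x + y) = g x + g y.
Proof. by rewrite -[x in LHS]scale1r topdualDZ mul1r. Qed.

Lemma topdual0 g : g 0 = 0.
Proof. by apply: (addrI (g 0)); rewrite -topdualD !addr0. Qed.

Lemma topdualZ g a x : g (a *: x) = a * g x.
Proof. by rewrite -[a *: x]addr0 topdualDZ topdual0 addr0. Qed.

Lemma topdualN g x : g (- x) = - g x.
Proof. by rewrite -scaleN1r topdualZ mulN1r. Qed.

Lemma topdualB g x y : g (x - y) = g x - g y.
Proof. by rewrite topdualD topdualN. Qed.

Definition topdualE := (topdual_fD, topdual_fN, topdual_fB, topdual_fZ,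
  topdual_f0, topdualD, topdualB, topdualN, topdualZ, topdual0).

Lemma topdual_neq0 g : g != 0 -> exists x, g x != 0.
Proof.
move=> g0; apply: contrapT => /forallNP gx0; move/eqP: g0; apply.
by apply: topdualP => x; apply/eqP; have /negP := gx0 x; rewrite negbK.
Qed.

Lemma dual_bounded (f : X -> R) : dual f ->
  exists M, forall x, `|f x| <= M * `|x|.
Proof.
move=> [lf cf].
have lf' : linear (f : X -> (R : normedModType R)) by [].
pose F := GRing.isLinear.Build R X (R : normedModType R) *:%R f lf'.
pose lF : {linear X -> (R : normedModType R)} := HB.pack f F.
have /linear_boundedP : bounded_near lF (nbhs 0).
  by apply: (@continuous_linear_bounded _ _ _ 0 lF); exact: cf.
by move=> /pinfty_ex_gt0[M _ MP]; exists M.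
Qed.

Lemma op_norm_ub (f : X -> R) x : dual f -> `|f x| <= op_norm f * `|x|.
Proof.
move=> df; have [M fM] := dual_bounded df; have [lf _] := df.
have fZ a y : f (a *: y) = a * f y.
  by have := topdualZ (Topdual (introT (asboolP _) df)) a y.
have [->|x0] := eqVneq x 0.
  by rewrite -(scale0r x) fZ mul0r scale0r !normr0 mulr0.
have nx : 0 < `|x| by rewrite normr_gt0.
rewrite -ler_pdivrMr// -[in `|x|^-1](normr_id x) -normrV ?unitfE ?gt_eqF//.
rewrite -normrM mulrC -fZ.
apply: ub_le_sup; last first.
  exists (`|x|^-1 *: x) => //=.
  by rewrite normrZ normfV normr_id mulVf ?gt_eqF.
exists `|M| => _ [y /= y1 <-].
apply: le_trans (fM y) _; apply: le_trans (ler_norm _) _.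
by rewrite normrM normr_id ler_piMr.
Qed.

Lemma op_norm_eq1 (f : X -> R) x : x != 0 -> (forall u, `|f u| <= `|u|) ->
  f x = `|x| -> dual f -> op_norm f = 1.
Proof.
move=> x0 fle fx df; have nx : 0 < `|x| by rewrite normr_gt0.
apply/eqP; rewrite eq_le; apply/andP; split.
  apply: ge_sup; first by exists `|f 0|; exists 0 => //=; rewrite normr0.
  by move=> _ [y /= y1 <-]; exact: le_trans (fle y) y1.
by have := op_norm_ub x df; rewrite fx normr_id ler_pMl.
Qed.

End TopologicalDual.
Arguments topdual {R} X.

(** The pointwise bound by the norm stands for dual norm at most one; the last clause is smoothness.
    At [0] only the bound remains. *)
Definition duality_map {R : realType} {X : normedModType R}
    (J : X -> topdual X) : Prop :=
  [/\ forall x, J x x = `|x|, forall x u, `|J x u| <= `|u| &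
    forall x (g : topdual X), x != 0 -> (forall u, `|g u| <= `|u|) ->
      g x = `|x| -> g = J x].

(** A functional supporting the unit ball at the normalised vector also supports it at the vector
    itself. *)
Lemma smooth_duality_map {R : realType} {X : normedModType R} :
  smooth X -> exists J : X -> topdual X, duality_map J /\ J 0 = 0.
Proof.
move=> smX.
have /choice[J JP] : forall x : X, exists g : topdual X,
  [/\ g x = `|x|, forall u, `|g u| <= `|u|, x != 0 ->
     forall h : topdual X, (forall u, `|h u| <= `|u|) -> h x = `|x| -> h = g &
     x = 0 -> g = 0].
  move=> x; have [->|x0] := eqVneq x 0.
    by exists 0; split=> [|u||]; rewrite ?topdual_f0 ?normr0.
  have nx : `|x| != 0 by rewrite normr_eq0.
  have nx1 : `| `|x|^-1 *: x| = 1 by rewrite normrZ normfV normr_id mulVf.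
  have [f fE] := smX _ nx1.
  have [[df f1] fx] : support_functionals (`|x|^-1 *: x) f by rewrite fE.
  pose g := Topdual (introT (asboolP _) df); exists g.
  split; last by move/eqP; rewrite (negbTE x0).
  - have := fx; rewrite nx1 -[f]/(g : X -> R) topdualZ => /(congr1 ( *%R `|x|)).
    by rewrite mulrA mulfV// mul1r mulr1.
  - by move=> u; have := op_norm_ub u df; rewrite f1 mul1r.
  - move=> _ h hle hx; apply: val_inj => /=.
    suff : support_functionals (`|x|^-1 *: x) h by rewrite fE.
    split; last by rewrite nx1 topdualZ hx mulVf.
    by split; [exact: topdual_dual|exact: op_norm_eq1 x0 hle hx (topdual_dual h)].
exists J; split; last by have [_ _ _] := JP 0; exact.
by split=> [x|x u|x g x0 gle gx]; have [? ? ? ?] := JP x; auto.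
Qed.

(** * Poles of closed hyperspaces *)

Section IndependentPair.
Context {R : fieldType} {V : lmodType R}.

Definition indep (u v : V) := forall a b : R, a *: u + b *: v = 0 -> a = 0 /\ b = 0.

Lemma not_indep (u v : V) : u != 0 -> ~ indep u v -> exists a, v = a *: u.
Proof.
move=> u0 /existsNP[a /existsNP[b /not_implyP[abE ab0]]].
have b0 : b != 0.
  apply/eqP => b0; apply: ab0; move: abE.
  rewrite b0 scale0r addr0 => /eqP.
  by rewrite scaler_eq0 (negbTE u0) orbF => /eqP.
exists (- b^-1 * a); rewrite mulNr scaleNr -scalerA.
have -> : a *: u = - (b *: v) by apply/eqP; rewrite -addr_eq0 abE.
by rewrite scalerN opprK scalerA mulVf// scale1r.
Qed.

End IndependentPair.

Section Poles.
Context {R : realType} {X : normedModType R} (J : X -> topdual X).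
Hypothesis JP : duality_map J.
Implicit Types (g h e d k : topdual X) (u v w x y z : X) (a b : R).

Let Jxx x : J x x = `|x|. Proof. by have [+ _ _] := JP; exact. Qed.
Let Jle x u : J x u <= `|u|.
Proof. by have [_ + _] := JP => /(_ x u); apply: le_trans; exact: ler_norm. Qed.
Let Juniq x g : x != 0 -> (forall u, `|g u| <= `|u|) -> g x = `|x| -> g = J x.
Proof. by have [_ _ +] := JP; exact. Qed.

Lemma duality_map_neq0 x : x != 0 -> J x != 0.
Proof.
move=> x0; apply/eqP => Jx0; move: (Jxx x).
by rewrite Jx0 topdual_f0 => /eqP; rewrite eq_sym normr_eq0 (negbTE x0).
Qed.

(* [ker g] is Birkhoff-orthogonal to [v]: for a smooth norm, [w] is orthogonal
   to [v] if and only if [J w v = 0]. *)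
Definition pole g v := forall w, g w = 0 -> J w v = 0.

Lemma poleZ g a v : pole g v -> pole g (a *: v).
Proof. by move=> gv w /gv; rewrite topdualZ => ->; rewrite mulr0. Qed.

Lemma poleZl g a v : a != 0 -> pole g v -> pole (a *: g) v.
Proof.
by move=> a0 gv w /eqP; rewrite topdual_fZ mulf_eq0 (negbTE a0) => /eqP/gv.
Qed.

Lemma poleZV g a v : a != 0 -> pole g (a *: v) -> pole g v.
Proof.
by move=> a0 /(poleZ a^-1); rewrite scalerA mulVf// scale1r.
Qed.

(** Take [w = v] in the definition: [J v v] is the norm of [v]. *)
Lemma pole_ker g v : pole g v -> g v = 0 -> v = 0.
Proof.
by move=> gv /gv; rewrite Jxx => /eqP; rewrite normr_eq0 => /eqP.
Qed.

(* The vectors killed by all [J w] with [w] in the codimension two subspace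
   [ker g ∩ ker h] are separated by [g] and [h], hence form a plane at most. *)
Lemma pole_pencil g h a b u1 u2 u3 : indep u1 u2 ->
  pole g u1 -> pole h u2 -> pole (a *: g + b *: h) u3 ->
  exists p q, u3 = p *: u1 + q *: u2.
Proof.
move=> ind pg ph pgh.
have inj p q r : g (p *: u1 + q *: u2 + r *: u3) = 0 ->
    h (p *: u1 + q *: u2 + r *: u3) = 0 -> p *: u1 + q *: u2 + r *: u3 = 0.
  set u := _ + _ => gu hu; apply/eqP; rewrite -normr_eq0 -Jxx {2}/u !topdualE.
  rewrite pg// ph// pgh; first by rewrite !mulr0 !addr0.
  by rewrite topdual_fD !topdual_fZ gu hu !mulr0 addr0.
(* If this determinant vanished, its cofactors would solve the homogeneous system, which by [inj]
   has only the zero solution. *)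
set D := g u1 * h u2 - g u2 * h u1.
have D0 : D != 0.
  apply/eqP => D0.
  have uD p q : p * g u1 + q * g u2 = 0 -> p * h u1 + q * h u2 = 0 ->
      p = 0 /\ q = 0.
    move=> E1 E2; apply: ind; have := inj p q 0.
    by rewrite scale0r addr0 !topdualE; apply.
  have [h2 h1] : h u2 = 0 /\ - h u1 = 0.
    by apply: uD; [rewrite -D0 /D; ring|ring].
  have [g2 g1] : g u2 = 0 /\ - g u1 = 0.
    by apply: uD; [ring|rewrite -oppr0 -D0 /D; ring].
  have [] : 1 = 0 :> R /\ 0 = 0 :> R.
    by apply: uD; rewrite mul0r mul1r addr0 -[LHS]opprK ?g1 ?h1 oppr0.
  by move/eqP; rewrite oner_eq0.
(* Cramer's rule: the combination agrees with [u3] under [g] and [h]. *)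
exists ((g u3 * h u2 - g u2 * h u3) / D), ((g u1 * h u3 - g u3 * h u1) / D).
apply/eqP; rewrite eq_sym -subr_eq0 -(scaleN1r u3); apply/eqP.
by apply: inj; rewrite !topdualE /D; field.
Qed.

Lemma pole_pencil0 g h a b u1 u2 u3 w : indep u1 u2 ->
  pole g u1 -> pole h u2 -> pole (a *: g + b *: h) u3 ->
  J w u1 = 0 -> J w u2 = 0 -> J w u3 = 0.
Proof.
move=> ind p1 p2 p3 w1 w2; have [p [q ->]] := pole_pencil ind p1 p2 p3.
by rewrite !topdualE w1 w2; ring.
Qed.

Hypothesis poleP : forall g, g != 0 -> exists v, g v = 1 /\ pole g v.

(** * Uniqueness of the normalised functional with a given pole *)

Section Injectivity.
Variable v : X.
Let D e := e v = 1 /\ pole e v.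

Let v0 e : D e -> v != 0.
Proof.
by move=> [ev _]; apply/eqP => v0; move/eqP: ev; rewrite v0 topdual0 eq_sym oner_eq0.
Qed.

(* Otherwise [J w], which is a combination of [e] and of the slid functional,
   would have a pole in the span of [v] and of the pole of the latter, and
   [J w] kills both. *)
Let D_slide e w : D e -> w != 0 -> J w v = 0 -> D (e - (e w / `|w|) *: J w).
Proof.
move=> De w0 wv; have [ev pe] := De; set r := _ - _.
have rv : r v = 1 by rewrite /r !topdualE ev wv; ring.
have nw : `|w| != 0 by rewrite normr_eq0.
have rw : r w = 0 by rewrite /r !topdualE Jxx; field.
have [ew|ew] := eqVneq (e w) 0.
  suff -> : r = e by [].
  by apply: topdualP => x; rewrite /r !topdualE ew; ring.
have r0 : r != 0.
  by apply/eqP => r0; move/eqP: rv; rewrite r0 topdual_f0 eq_sym oner_eq0.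
have [u [ru pu]] := poleP r0.
apply: contrapT => nD.
have ind : indep v u.
  apply: contrapT => /(not_indep (v0 De))[a uE]; apply: nD; split => //.
  apply: (@poleZV _ a); last by rewrite -uE.
  by apply/eqP => a0; move/eqP: ru; rewrite uE a0 scale0r topdual0 eq_sym oner_eq0.
have [q [qJ pq]] := poleP (duality_map_neq0 w0).
suff : J w q = 0 by move/eqP; rewrite qJ oner_eq0.
apply: (pole_pencil0 (a := `|w| / e w) (b := - (`|w| / e w)) ind pe pu) => //.
  suff <- : J w = (`|w| / e w) *: e + - (`|w| / e w) *: r by [].
  by apply: topdualP => x; rewrite /r !topdualE; field; rewrite nw ew.
exact: pu.
Qed.

(* So [D] is a prism with axis [J w] over its slices by the level sets of the
   evaluation at [w]. *)
Let D_prism g e d w : D g -> D e -> D d -> g w = 0 -> w != 0 ->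
  D (e + ((d w - e w) / `|w|) *: J w).
Proof.
move=> [gv pg] De Dd gw w0; have [dv pd] := Dd; have [ev pe] := De.
have wv : J w v = 0 by exact: pg.
pose y := w - d w *: v.
(* Both [J w] and [J y] kill [v], so [y] and [w] have equal norm and the same support functional;
   sliding [e] along [y] then moves it along [J w]. *)
have yv : J y v = 0 by apply: pd; rewrite /y !topdualE dv; ring.
have Jwy : J w y = `|w| by rewrite /y !topdualE wv Jxx; ring.
have yw : `|y| = `|w|.
  apply/eqP; rewrite eq_le -{2}Jwy Jle andbT -Jxx {2}/y !topdualE yv mulr0 subr0.
  exact: Jle.
have y0 : y != 0 by rewrite -normr_eq0 yw normr_eq0.
have JwJy : J w = J y.
  by apply: Juniq; rewrite ?yw//; have [_ + _] := JP; exact.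
have := D_slide De y0 yv; rewrite -JwJy yw.
suff -> : e - e y / `|w| *: J w = e + ((d w - e w) / `|w|) *: J w by [].
by apply: topdualP => x; rewrite !topdualE ev; ring.
Qed.

(** Projecting onto [ker e] along [v] does not increase the norm. *)
Let D_bound e w : D e -> `|e w| * `|v| <= 2 * `|w|.
Proof.
move=> [ev pe]; pose y := w - e w *: v.
have yv : J y v = 0 by apply: pe; rewrite /y !topdualE ev; ring.
have yw : `|y| <= `|w|.
  by rewrite -Jxx {2}/y !topdualE yv mulr0 subr0 Jle.
rewrite -normrZ; have -> : e w *: v = w - y by rewrite /y opprB addrC subrK.
by apply: le_trans (ler_normB _ _) _; lra.
Qed.

(** Near-maximisers over [D] of the evaluation at [x] nearly maximise the evaluation at [w]; the
    slack is there because the supremum is not known to be attained. *)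
Let follows x w := forall eps, 0 < eps -> exists2 del, 0 < del &
  forall e, D e -> (forall d, D d -> d x <= e x + del) ->
    forall d, D d -> d w <= e w + eps.

(** If some [d] beat [e] at [w2], the prism property would let [e] move along [J w2], raising its
    value at [w1] too, since closeness of [w1] to [w2] makes [J w2 w1] positive. *)
Let follows_step g x w1 w2 : D g -> g w2 = 0 -> `|w2 - w1| < `|w2| ->
  follows x w1 -> follows x w2.
Proof.
move=> Dg gw2 w12 xw1 eps eps0.
have nw2 : 0 < `|w2| by exact: le_lt_trans w12.
have k0 : 0 < J w2 w1 / `|w2|.
  apply: divr_gt0 => //; have := Jle w2 (w2 - w1).
  by rewrite topdualB Jxx; lra.
have [del del0 delP] := xw1 _ (mulr_gt0 eps0 k0).
exists del => // e De emax d Dd.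
have w20 : w2 != 0 by rewrite -normr_gt0.
have := delP _ De emax _ (D_prism Dg De Dd gw2 w20).
rewrite !topdualE lerD2l -mulrA [_^-1 * _]mulrC ler_pM2r// lerBlDr.
by rewrite addrC.
Qed.

(* The path leads from [x] to [- x] through [x + 3 z], [3 z] and [- x + 3 z], in
   steps shorter than the norm of their end point. *)
Let follows_opp g x z : D g -> g x = 0 -> g z = 0 -> `|x| = 1 -> `|z| = 1 ->
  J x z = 0 -> follows x (- x).
Proof.
move=> Dg gx gz x1 z1 xz.
(* [ge_s] serves the half steps along [z], where [s'] is 1 or -1; [ge_t] serves the unit steps along
   [x] at height 3, where it bounds the norm below by 2. *)
have ge_s s t : `|s| <= `|s *: x + t *: z|.
  have <- : `|J x (s *: x + t *: z)| = `|s|.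
    by rewrite !topdualE xz mulr0 addr0 Jxx x1 mulr1.
  by have [_ + _] := JP; exact.
have ge_t s t : `|t| - `|s| <= `|s *: x + t *: z|.
  have : `|t *: z| <= `|s *: x + t *: z| + `|s *: x|.
    rewrite -{1}[t *: z](addKr (s *: x)) addrC; exact: ler_normB.
  by rewrite !normrZ x1 z1; lra.
have step s t s' t' : `|s' - s| + `|t' - t| < `|s'| \/
    `|s' - s| + `|t' - t| < `|t'| - `|s'| ->
    follows x (s *: x + t *: z) -> follows x (s' *: x + t' *: z).
  move=> st; apply: (follows_step Dg); first by rewrite !topdualE gx gz; ring.
  have -> : s' *: x + t' *: z - (s *: x + t *: z)
    = (s' - s) *: x + (t' - t) *: z by rewrite !scalerBl opprD addrACA.
  have := ler_normD ((s' - s) *: x) ((t' - t) *: z).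
  rewrite !normrZ x1 z1 !mulr1; move: (ge_s s' t') (ge_t s' t').
  by case: st; lra.
have up n : follows x (1 *: x + (n%:R / 2) *: z).
  elim: n => [|n IH].
    by rewrite scale1r mul0r scale0r addr0 => eps eps0; exists eps.
  apply: step IH; left; rewrite subrr normr0 add0r normr1 -mulrBl -natrB//.
  by rewrite subSnn ger0_norm; lra.
have mid : follows x (0 *: x + 3 *: z).
  apply: (@step 1 3); first by right; rewrite subrr sub0r normrN normr0 normr1 ger0_norm; lra.
  by have := up 6; have -> : 6%:R / 2 = 3 :> R by lra.
have down n : follows x (-1 *: x + (3 - n%:R / 2) *: z).
  elim: n => [|n IH].
    apply: (@step 0 3) => //; right.
    by rewrite mul0r !subr0 subrr normrN normr0 normr1 ger0_norm; lra.
  apply: step IH; left; rewrite subrr normr0 add0r normrN normr1.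
  have -> : 3 - n.+1%:R / 2 - (3 - n%:R / 2) = - (1 / 2) :> R.
    by rewrite -addn1 natrD; lra.
  by rewrite normrN ger0_norm; lra.
have := down 6; have -> : 3 - 6%:R / 2 = 0 :> R by lra.
by rewrite scale0r addr0 scaleN1r.
Qed.

(** A near-maximiser at [x] is also one at [- x], so the evaluation at [x] is nearly constant on
    [D], yet it separates [g] from [h]. *)
Lemma pole_inj g h : (forall g1 g2, exists2 u, u != 0 & g1 u = 0 /\ g2 u = 0) ->
  D g -> D h -> g = h.
Proof.
move=> dim3 Dg Dh; have [gv pg] := Dg; have [hv ph] := Dh.
apply: contrapT => gh.
have [y [gy hy]] : exists y, g y = 0 /\ h y != 0.
  apply: contrapT => /forallNP nE; apply: gh; apply: topdualP => u.
  apply/eqP; rewrite eq_sym -subr_eq0; apply/negPn/negP => hgu.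
  apply: (nE (u - g u *: v)); rewrite !topdualE gv hv; split; first by ring.
  by rewrite mulr1.
have y0 : y != 0 by apply/eqP => y0; move: hy; rewrite y0 topdual0 eqxx.
have ny : `|y| != 0 by rewrite normr_eq0.
pose x := `|y|^-1 *: y.
have x1 : `|x| = 1 by rewrite normrZ normfV normr_id mulVf.
have gx : g x = 0 by rewrite topdualZ gy mulr0.
have hx : h x != 0 by rewrite topdualZ mulf_neq0// invr_eq0.
have [t t0 [gt Jt]] := dim3 g (J x).
have nt : `|t| != 0 by rewrite normr_eq0.
have z1 : `| `|t|^-1 *: t| = 1 by rewrite normrZ normfV normr_id mulVf.
(* Two errors of a third leave a spread below the gap between [g x = 0] and [h x]. *)
have hx3 : 0 < `|h x| / 3 by apply: divr_gt0; rewrite ?normr_gt0.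
have [||del del0 delP] := follows_opp Dg gx _ x1 z1 _ hx3.
- by rewrite topdualZ gt mulr0.
- by rewrite topdualZ Jt mulr0.
pose S := [set d x | d in [set d | D d]].
have supS : has_sup S.
  split; first by exists (g x); exists g.
  exists (2 / `|v|) => _ [d Dd <-]; apply: le_trans (ler_norm _) _.
  rewrite ler_pdivlMr ?normr_gt0 ?(v0 Dg)//; apply: le_trans (D_bound x Dd) _.
  by rewrite x1 mulr1.
have min0 : 0 < Num.min del (`|h x| / 3) by rewrite lt_min del0 hx3.
have [_ [e De <-] eS] := sup_adherent min0 supS.
have emax d : D d -> d x <= e x + Num.min del (`|h x| / 3).
  move=> Dd; have : d x <= sup S by apply: ub_le_sup; [exact: supS.2|exists d].
  lra.
have m1 : Num.min del (`|h x| / 3) <= del by rewrite ge_min lexx.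
have m2 : Num.min del (`|h x| / 3) <= `|h x| / 3 by rewrite ge_min lexx orbT.
have low d : D d -> - d x <= - e x + `|h x| / 3.
  by rewrite -!topdualN; apply: delP => // d' /emax/le_trans; apply; rewrite lerD2l.
have := low _ Dg; have := low _ Dh; have := emax _ Dg; have := emax _ Dh.
rewrite gx; move: m2 hx3; set m := Num.min _ _.
by have [?|?] := ger0P (h x); lra.
Qed.

End Injectivity.
End Poles.

(** * Linearity of the duality map up to scaling *)

(** Nonnegative reals are squares, so [s] preserves order; being additive, it also fixes the
    integers. *)
Lemma additive_square_id (R : realType) (s : R -> R) :
  (forall a b, s (a + b) = s a + s b) -> (forall a, s (a * a) = s a * s a) ->
  s 1 = 1 -> forall a, s a = a.
Proof.
move=> sD sM s1.
have s0 : s 0 = 0 by apply: (addrI (s 0)); rewrite -sD !addr0.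
have sN a : s (- a) = - s a by apply/eqP; rewrite -addr_eq0 -sD addNr s0.
have sn a n : s (a *+ n) = s a *+ n.
  by elim: n => [|n IH]; rewrite ?mulr0n// !mulrS sD IH.
have sz (z : int) : s z%:~R = z%:~R.
  by case: z => n; rewrite ?NegzE ?mulrNz ?sN -!pmulrn sn s1.
have s_ge0 a : 0 <= a -> 0 <= s a.
  by move=> a0; rewrite -(sqr_sqrtr a0) expr2 sM -expr2 sqr_ge0.
have le a : a <= s a.
  rewrite leNgt; apply/negP => sa.
  have d0 : 0 < a - s a by rewrite subr_gt0.
  (* Multiplying by [n] makes the gap exceed 1, but [s (a *+ n)] is at least the floor of
     [a *+ n]. *)
  pose n := Num.Def.archi_bound (a - s a)^-1.
  have nd : 1 < (a - s a) *+ n.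
    rewrite -[ltRHS]mulr_natr -ltr_pdivrMl// mulr1.
    by apply: archi_boundP; rewrite invr_ge0 ltW.
  have := s_ge0 (a *+ n - (Num.floor (a *+ n))%:~R).
  rewrite subr_ge0 floor_le => /(_ isT).
  rewrite sD sN sz sn subr_ge0 => fs.
  have := floorD1_gt (a *+ n); rewrite intrD => fa.
  by move: nd; rewrite mulrnBl; lra.
move=> a; apply/eqP; rewrite eq_le le andbT.
by rewrite -lerN2 -sN le.
Qed.

Section Linearization.
Context {R : realType} {X : normedModType R} (J : X -> topdual X).
Hypothesis JP : duality_map J.
Implicit Types (g h k l m : topdual X) (u v w x y z : X) (a b : R).
Hypothesis poleP : forall g, g != 0 -> exists v, g v = 1 /\ pole J g v.
Hypothesis dim3 :
  forall g1 g2 : topdual X, exists2 u, u != 0 & g1 u = 0 /\ g2 u = 0.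

Let Jxx x : J x x = `|x|. Proof. by have [+ _ _] := JP; exact. Qed.

Local Notation pole := (pole J).

Lemma poleB g x y : pole g x -> pole g y -> pole g (x - y).
Proof. by move=> gx gy w gw; rewrite topdualB gx// gy// subrr. Qed.

(** The difference of the two sides is a pole of [g] lying in [ker g]. *)
Lemma pole_line g x y : x != 0 -> pole g x -> pole g y -> y = (g y / g x) *: x.
Proof.
move=> x0 gx gy.
have gx0 : g x != 0 by apply/eqP => /(pole_ker JP gx)/eqP; rewrite (negbTE x0).
apply/eqP; rewrite -subr_eq0; apply/eqP; apply: (@pole_ker _ _ _ JP g).
  by apply: poleB => //; exact: poleZ.
by rewrite !topdualE; field.
Qed.

(** Normalise both functionals at [u] and apply [pole_inj]. *)
Lemma pole_functional g h u : u != 0 -> pole g u -> pole h u ->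
  h = (h u / g u) *: g.
Proof.
move=> u0 gu hu.
have nz k : pole k u -> k u != 0.
  by move=> ku; apply/eqP => /(pole_ker JP ku)/eqP; rewrite (negbTE u0).
have Dn k : pole k u -> ((k u)^-1 *: k) u = 1 /\ pole ((k u)^-1 *: k) u.
  move=> ku; split; first by rewrite topdualE mulVf ?nz.
  by apply: (poleZl _ ku); rewrite invr_eq0 nz.
have := pole_inj JP poleP dim3 (Dn _ gu) (Dn _ hu).
by move=> /(congr1 ( *:%R (h u))); rewrite !scalerA divff ?nz// scale1r.
Qed.

Lemma pole_indep0 g h u : indep g h -> pole g u -> pole h u -> u = 0.
Proof.
move=> gh gu hu; apply/eqP/negPn/negP => u0.
have hE := pole_functional u0 gu hu.
have [_ /eqP] : h u / g u = 0 /\ -1 = 0 :> R.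
  by apply: gh; rewrite -hE scaleN1r subrr.
by rewrite oppr_eq0 oner_eq0.
Qed.

Lemma poles_indep g h u v : indep g h -> u != 0 -> v != 0 ->
  pole g u -> pole h v -> indep u v.
Proof.
move=> gh u0 v0 gu hv; apply: contrapT => /(not_indep u0)[a vE].
have a0 : a != 0 by apply/eqP => a0; rewrite vE a0 scale0r eqxx in v0.
move/eqP: u0; apply; apply: (pole_indep0 gh) => //.
by apply: (poleZV a0); rewrite -vE.
Qed.

(* Otherwise every [h] would be a combination of [g] and of a functional
   vanishing at [w], so [J w] would kill all poles, including that of [J w]. *)
Lemma pole_strict g u w : u != 0 -> pole g u -> J w u = 0 -> g w = 0.
Proof.
move=> u0 gu wu; apply/eqP/negPn/negP => gw.
have w0 : w != 0 by apply/eqP => w0; move: gw; rewrite w0 topdual0 eqxx.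
have [q [qJ pq]] := poleP (duality_map_neq0 JP w0).
suff : J w q = 0 by move/eqP; rewrite qJ oner_eq0.
pose r := J w - (`|w| / g w) *: g.
have rw : r w = 0 by rewrite !topdualE Jxx; field.
have JE : J w = (`|w| / g w) *: g + 1 *: r.
  by apply: topdualP => x; rewrite !topdualE; ring.
have [r0|r0] := eqVneq r 0.
  have pu : pole (J w) u.
    rewrite JE r0 scaler0 addr0; apply: (poleZl _ gu).
    by rewrite mulf_neq0 ?invr_eq0// normr_eq0.
  by rewrite (pole_line u0 pu pq) topdualE wu mulr0.
have [v [rv pv]] := poleP r0.
have v0 : v != 0.
  by apply/eqP => v0; move/eqP: rv; rewrite v0 topdual0 eq_sym oner_eq0.
have gr : indep g r.
  have g0 : g != 0 by apply/eqP => g0; move: gw; rewrite g0 topdual_f0 eqxx.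
  apply: contrapT => /(not_indep g0)[a rE]; move/eqP: rw.
  by rewrite rE topdualE mulf_eq0 (negbTE gw) orbF => /eqP a0;
    move: r0; rewrite rE a0 scale0r eqxx.
apply: (pole_pencil0 JP (a := `|w| / g w) (b := 1) _ gu pv) => //.
- exact: poles_indep gr u0 v0 gu pv.
- by rewrite -JE.
- exact: pv.
Qed.

(** * Affine charts and a linear choice of poles *)

Section Chart.
Variable w0 : X.
Hypothesis w01 : `|w0| = 1.
Let f0 := J w0.

Let f0w : f0 w0 = 1. Proof. by rewrite /f0 Jxx. Qed.

(** By [pole_strict], [f0] does not vanish at a nonzero pole of [g] when [g w0 = 1], so the pole can
    be normalised. *)
Let chart_exists : exists T : topdual X -> X,
  forall g, g w0 = 1 -> pole g (T g) /\ f0 (T g) = 1.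
Proof.
suff /choice[T TP] : forall g, exists v, g w0 = 1 -> pole g v /\ f0 v = 1.
  by exists T.
move=> g; have [gw|/eqP gw] := eqVneq (g w0) 1; last by exists 0.
have g0 : g != 0.
  by apply/eqP => g0; move/eqP: gw; rewrite g0 topdual_f0 eq_sym oner_eq0.
have [v [gv pv]] := poleP g0.
have v0 : v != 0.
  by apply/eqP => v0; move/eqP: gv; rewrite v0 topdual0 eq_sym oner_eq0.
have f0v : f0 v != 0.
  by apply/eqP => /(pole_strict v0 pv)/eqP; rewrite gw oner_eq0.
exists ((f0 v)^-1 *: v) => _; split; first exact: poleZ.
by rewrite topdualE mulVf.
Qed.

(* In the affine charts [g w0 = 1] and [f0 v = 1] the map from functionals to
   poles sends lines to lines and, by [pole_strict], points at infinity to
   points at infinity; parallelograms then give additivity. *)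
Lemma linear_poles : exists T : topdual X -> X,
  (forall a g h, T (a *: g + h) = a *: T g + T h) /\
  forall g, pole g (T g) /\ (g != 0 -> T g != 0).
Proof.
have [T TP] := chart_exists.
have pT g : g w0 = 1 -> pole g (T g) by move=> /TP[].
have fT g : g w0 = 1 -> f0 (T g) = 1 by move=> /TP[].
have T0 g : g w0 = 1 -> T g != 0.
  move=> /fT gT; apply/eqP => T0; move/eqP: gT.
  by rewrite T0 topdual0 eq_sym oner_eq0.
(* The displacement of the pole as [g] moves by [k]; for [k w0 = 0] it is itself a pole of [k]. *)
pose t g k := T (g + k) - T g.
have addw g k : g w0 = 1 -> k w0 = 0 -> (g + k) w0 = 1.
  by move=> gw kw; rewrite topdualE gw kw addr0.
have pt g k : g w0 = 1 -> k w0 = 0 -> pole k (t g k).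
  move=> gw kw; have [->|k0] := eqVneq k 0.
    by rewrite /t addr0 subrr => w _; rewrite topdual0.
  have [p [kp pp]] := poleP k0.
  have p0 : p != 0.
    by apply/eqP => p0; move/eqP: kp; rewrite p0 topdual0 eq_sym oner_eq0.
  have gk : indep g k.
    move=> a b ab; have a0 : a = 0.
      have : (a *: g + b *: k) w0 = 0 by rewrite ab.
      by rewrite !topdualE gw kw mulr0 addr0 mulr1.
    split=> //; move/eqP: ab; rewrite a0 scale0r add0r scaler_eq0 (negbTE k0).
    by rewrite orbF => /eqP.
  have pgk : pole (1 *: g + 1 *: k) (T (g + k)).
    by rewrite !scale1r; apply: pT; exact: addw.
  have [a [b E]] := pole_pencil JP (poles_indep gk (T0 _ gw) p0 (pT _ gw) pp)
    (pT _ gw) pp pgk.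
  (* Apply [f0 = J w0], which kills [p] because [k w0 = 0]. *)
  have a1 : a = 1.
    have := fT _ (addw _ _ gw kw); rewrite E !topdualE fT// /f0 (pp _ kw).
    by rewrite mulr0 addr0 mulr1.
  by rewrite /t E a1 scale1r addrAC subrr add0r; exact: poleZ.
have t0 g k : g w0 = 1 -> k w0 = 0 -> k != 0 -> t g k != 0.
  move=> gw kw k0; apply/negP; rewrite subr_eq0 => /eqP TT.
  have gkw := addw _ _ gw kw.
  have pgk : pole (g + k) (T g) by rewrite -TT; exact: pT.
  have := pole_functional (T0 _ gw) (pT _ gw) pgk; set a := _ / _ => E.
  have a1 : a = 1 by have := gkw; rewrite E topdual_fZ gw mulr1.
  move/eqP: E; rewrite a1 scale1r.
  by rewrite -subr_eq0 addrAC subrr add0r (negbTE k0).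
(* The difference of opposite sides of the parallelogram is a pole of [k] and, regrouped, of [l];
   hence it is zero. *)
have tind g k l : g w0 = 1 -> k w0 = 0 -> l w0 = 0 -> indep k l ->
    t (g + l) k = t g k.
  move=> gw kw lw kl; apply/eqP; rewrite eq_sym -subr_eq0; apply/eqP.
  apply: (pole_indep0 kl); first by apply: poleB; apply: pt => //; exact: addw.
  have -> : t g k - t (g + l) k = t g l - t (g + k) l.
    rewrite /t (addrAC g l k) !opprB [RHS]addrACA [LHS]addrACA.
    by rewrite [T (g + l) + _]addrC; congr (_ + _); rewrite addrC.
  by apply: poleB; apply: pt => //; exact: addw.
have other k : k w0 = 0 -> k != 0 -> exists m, m w0 = 0 /\ indep k m.
  move=> kw k0; have [u u0 [ku fu]] := dim3 k f0.
  exists (J u - J u w0 *: f0); split; first by rewrite !topdualE f0w; ring.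
  move=> a b ab; have b0 : b = 0.
    have : (a *: k + b *: (J u - J u w0 *: f0)) u = 0 by rewrite ab.
    rewrite !topdualE ku fu !mulr0 add0r subr0 Jxx => /eqP.
    by rewrite mulf_eq0 normr_eq0 (negbTE u0) orbF => /eqP.
  split=> //; move/eqP: ab; rewrite b0 scale0r addr0 scaler_eq0 (negbTE k0).
  by rewrite orbF => /eqP.
have tE g k l : g w0 = 1 -> k w0 = 0 -> l w0 = 0 -> t (g + l) k = t g k.
  move=> gw kw lw; have [->|k0] := eqVneq k 0; first by rewrite /t !addr0 !subrr.
  have [kl|/(not_indep k0)[a lE]] := pselect (indep k l); first exact: tind.
  (* When [l] is parallel to [k], move by [m] and then by [l - m], both independent of [k]. *)
  have [m [mw km]] := other _ kw k0.
  rewrite -(tind _ _ _ gw kw mw km) -[RHS](tind _ _ (l - m))//.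
  - by rewrite addrA addrAC addrK.
  - exact: addw.
  - by rewrite !topdualE lw mw subrr.
  - move=> b c bc; have [bca c0] : b + c * a = 0 /\ - c = 0.
      apply: km; rewrite -bc lE; apply: topdualP => x; rewrite !topdualE; ring.
    have c1 : c = 0 by lra.
    by split=> //; rewrite -bca c1 mul0r addr0.
pose s k := t f0 k.
have sD k l : k w0 = 0 -> l w0 = 0 -> s (k + l) = s k + s l.
  move=> kw lw; rewrite -[s l](tE _ _ k)// /s /t addrA [RHS]addrC.
  by rewrite addrA subrK.
have s00 : s 0 = 0 by rewrite /s /t addr0 subrr.
have Zw a k : k w0 = 0 -> (a *: k) w0 = 0.
  by move=> kw; rewrite topdualE kw mulr0.
have ps k : k w0 = 0 -> pole k (s k) by move=> kw; exact: pt.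
have sn0 k : k w0 = 0 -> k != 0 -> s k != 0 by move=> kw; exact: t0.
(* The factor by which [s] responds to scaling by [a]; it agrees on independent directions, which
   forces it to respect squares. *)
pose c k a := k (s (a *: k)) / k (s k).
have sc k a : k w0 = 0 -> k != 0 -> s (a *: k) = c k a *: s k.
  move=> kw k0; apply: pole_line; [exact: sn0|exact: ps|].
  have [->|a0] := eqVneq a 0.
    by rewrite scale0r s00 => w _; rewrite topdual0.
  rewrite -{1}[k]scale1r -(mulVf a0) -scalerA; apply: poleZl.
    by rewrite invr_eq0.
  by apply: ps; exact: Zw.
have cE k l a : k w0 = 0 -> l w0 = 0 -> k != 0 -> l != 0 -> indep k l ->
    c k a = c l a.
  move=> kw lw k0 l0 kl.
  have klw : (k + l) w0 = 0 by rewrite topdualE kw lw addr0.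
  have kl0 : k + l != 0.
    apply/eqP => E; have [/eqP] : 1 = 0 :> R /\ 1 = 0 :> R.
      by apply: kl; rewrite !scale1r.
    by rewrite oner_eq0.
  have := sc _ a klw kl0; rewrite [a *: _]scalerDr !sD ?Zw// !sc// [RHS]scalerDr => E.
  have [] : c k a - c (k + l) a = 0 /\ c l a - c (k + l) a = 0; last by lra.
  apply: (poles_indep kl (sn0 _ kw k0) (sn0 _ lw l0) (ps _ kw) (ps _ lw)).
  by rewrite [_ *: s k]scalerBl [_ *: s l]scalerBl addrACA -opprD E subrr.
have c_id k a : k w0 = 0 -> k != 0 -> c k a = a.
  move=> kw k0; move: a; apply: additive_square_id.
  - move=> a b; apply/eqP; rewrite -subr_eq0.
    have := sn0 _ kw k0; apply: contraNT => /negbTE cab.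
    suff : (c k (a + b) - (c k a + c k b)) *: s k == 0.
      by rewrite scaler_eq0 cab.
    by rewrite scalerBl [X in _ - X]scalerDl -!sc// scalerDl sD ?Zw// subrr.
  - move=> a; have [->|a0] := eqVneq a 0.
      by rewrite mulr0 /c scale0r s00 topdual0 mul0r mulr0.
    have [m [mw km]] := other _ kw k0.
    have m0 : m != 0.
      apply/eqP => m0; have [_ /eqP] : 0 = 0 :> R /\ 1 = 0 :> R.
        by apply: km; rewrite m0 scaler0 scale0r addr0.
      by rewrite oner_eq0.
    have ak0 : a *: k != 0 by rewrite scaler_eq0 negb_or a0.
    have akm : indep (a *: k) m.
      move=> p q; rewrite scalerA => /km[/eqP].
      by rewrite mulf_eq0 (negbTE a0) orbF => /eqP.
    (* Comparison with [m] shows that [a *: k] and [k] have the same factor for [a]. *)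
    have E : s ((a * a) *: k) = (c k a * c k a) *: s k.
      rewrite -scalerA sc ?Zw// (cE _ m)// ?Zw// -(cE k)// sc// scalerA //.
    apply/eqP; rewrite -subr_eq0.
    have := sn0 _ kw k0; apply: contraNT => /negbTE cab.
    suff : (c k (a * a) - (c k a * c k a)) *: s k == 0.
      by rewrite scaler_eq0 cab.
    by rewrite scalerBl -E sc// subrr.
  - rewrite /c scale1r divff//; apply/eqP => /(pole_ker JP (ps _ kw))/eqP.
    by rewrite (negbTE (sn0 _ kw k0)).
have sZ a k : k w0 = 0 -> s (a *: k) = a *: s k.
  move=> kw; have [->|k0] := eqVneq k 0; first by rewrite scaler0 s00 scaler0.
  by rewrite sc// c_id.
(* Linear extension from the chart with origin [f0]: split [g] into a multiple of [f0] and a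
   functional vanishing at [w0]. *)
pose L g := g w0 *: T f0 + s (g - g w0 *: f0).
have Uw g : (g - g w0 *: f0) w0 = 0 by rewrite !topdualE f0w; ring.
exists L; split.
  move=> a g h; rewrite /L.
  have -> : a *: g + h - (a *: g + h) w0 *: f0 =
      a *: (g - g w0 *: f0) + (h - h w0 *: f0).
    by apply: topdualP => x; rewrite !topdualE; ring.
  rewrite (sD (a *: (g - g w0 *: f0))) ?Zw ?Uw// sZ ?Uw//.
  rewrite topdual_fD topdual_fZ scalerDl -scalerA [in RHS]scalerDr.
  exact: addrACA.
move=> g; have [gw|gw] := eqVneq (g w0) 0.
  rewrite /L gw !scale0r add0r subr0; split; first exact: ps.
  exact: sn0.
have LE : L g = g w0 *: T ((g w0)^-1 *: g).
  have gE : g - g w0 *: f0 = g w0 *: ((g w0)^-1 *: g - f0).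
    by rewrite scalerBr scalerA divff// scale1r.
  rewrite /L gE sZ; last by rewrite !topdualE f0w; field.
  by rewrite -scalerDr /s /t addrCA subrr addr0 addrC subrK.
have g1 : ((g w0)^-1 *: g) w0 = 1 by rewrite topdualE mulVf.
split=> [|_]; last by rewrite LE scaler_eq0 negb_or gw T0.
rewrite LE; apply: poleZ; rewrite -{1}[g]scale1r -(divff gw) -scalerA.
by apply: poleZl gw _; exact: pT.
Qed.

End Chart.

(** [S] is a transpose of the linear pole map: [S w (T g) = g w], linear in [w]. *)
Lemma linear_duality : (exists w : X, w != 0) -> exists S : X -> topdual X,
  (forall a x y, S (a *: x + y) = a *: S x + S y) /\
  forall w, w != 0 -> exists2 c, c != 0 & J w = c *: S w.
Proof.
move=> [w1 w10].
have nw1 : `| `|w1|^-1 *: w1| = 1.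
  by rewrite normrZ normfV normr_id mulVf// normr_eq0.
have [T [TL TP]] := linear_poles nw1.
have nz g : g != 0 -> g (T g) != 0.
  move=> g0; have [pg /(_ g0) Tg0] := TP g.
  by apply/eqP => /(pole_ker JP pg)/eqP; rewrite (negbTE Tg0).
have T0 : T 0 = 0.
  have := TL 1 0 0; rewrite !scale1r addr0 => E.
  by apply: (addrI (T 0)); rewrite addr0.
pose c w := J w (T (J w)) / `|w|.
pose S w := if w == 0 then 0 else (c w)^-1 *: J w.
have c0 w : w != 0 -> c w != 0.
  move=> w0; rewrite mulf_neq0 ?invr_eq0 ?normr_eq0//.
  by apply: nz; exact: duality_map_neq0.
have ST w g : S w (T g) = g w.
  rewrite /S; case: eqVneq => [->|w0]; first by rewrite topdual_f0 topdual0.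
  have nw : `|w| != 0 by rewrite normr_eq0.
  (* [T r] is a pole of [r] and [r w = 0], so [J w] kills [T r]. *)
  pose r := g - (g w / `|w|) *: J w.
  have rw : r w = 0 by rewrite !topdualE Jxx; field.
  have gE : g = (g w / `|w|) *: J w + r.
    by apply: topdualP => x; rewrite !topdualE; ring.
  rewrite {1}gE TL !topdualE (TP r).1// addr0 /c.
  by field; rewrite nw nz// duality_map_neq0.
exists S; split=> [a x y|w w0]; last first.
  exists (c w); first exact: c0.
  by rewrite /S (negbTE w0) scalerA divff ?c0// scale1r.
(* The defect of linearity vanishes at its own pole, hence is zero. *)
apply/eqP; rewrite -subr_eq0; apply/negPn/negP => /nz/negP; apply.
by apply/eqP; rewrite !(topdual_fD, topdual_fN, topdual_fZ) !ST !topdualE; ring.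
Qed.

End Linearization.

(** * The norm is a quadratic form *)

(** The inequality used at both ends traps the difference quotient between [df x] and [df z]. *)
Lemma is_derive_subgradient (R : realType) (f df : R -> R) (x : R) :
  (forall s t, df t * (s - t) <= f s - f t) -> {for x, continuous df} ->
  is_derive x 1 f (df x).
Proof.
move=> sub cdf; apply/is_derive1_caratheodory.
pose q z := if z == x then df x else (f z - f x) / (z - x).
have qx : q x = df x by rewrite /q eqxx.
exists q; split=> //.
  move=> z; rewrite /q; case: eqVneq => [->|zx]; first by rewrite !subrr mulr0.
  by rewrite divfK// subr_eq0.
have qdf z : `|df x - q z| <= `|df x - df z|.
  rewrite /q; case: eqVneq => [->|zx]; first by rewrite subrr normr0.
  have xz := sub x z; have zx' := sub z x.
  have [lt|ge] := ltrP x z.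
    have d0 : 0 < z - x by rewrite subr_gt0.
    have a1 : df x <= (f z - f x) / (z - x) by rewrite ler_pdivlMr.
    have a2 : (f z - f x) / (z - x) <= df z by rewrite ler_pdivrMr//; lra.
    by rewrite !ler0_norm ?subr_le0//; lra.
  have d0 : 0 < x - z by rewrite subr_gt0 lt_neqAle zx.
  have -> : (f z - f x) / (z - x) = (f x - f z) / (x - z).
    by rewrite -[z - x]opprB invrN mulrN -mulNr opprB.
  have a1 : df z <= (f x - f z) / (x - z) by rewrite ler_pdivlMr.
  have a2 : (f x - f z) / (x - z) <= df x by rewrite ler_pdivrMr//; lra.
  by rewrite !ger0_norm ?subr_ge0//; lra.
apply/cvgrPdist_le => e e0; rewrite qx.
move/cvgrPdist_le : cdf => /(_ _ e0); apply: filterS => z.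
exact: le_trans (qdf z).
Qed.

Lemma symmetric_form_dot (R : realType) (X : lmodType R) (f : X -> X -> R) :
  (forall y, scalar (f ^~ y)) -> (forall x y, f x y = f y x) ->
  (forall x, x != 0 -> 0 < f x x) ->
  exists d : {dot X for @idfun R}, forall x y, d x y = f x y.
Proof.
move=> fl fs fp.
have fr x : scalar (f x).
  by move=> a y z; rewrite fs fl (fs y) (fs z).
have fh x y : f x y = (-1) ^+ false * idfun (f y x) by rewrite expr0 mul1r fs.
pose b := isBilinear.Build R X X R *%R (@idfun R \; *%R) f
  (fun u => zmod_morphism_linear (fl u)) (fun u => zmod_morphism_linear (fr u))
  (fun u => scalable_linear (fl u)) (fun u => scalable_linear (fr u)).
pose h := isHermitianSesquilinear.Build R X false (@idfun R) f fh.
pose p := isDotProduct.Build R X f fp.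
pose d : {dot X for @idfun R} := HB.pack f b h p.
by exists d.
Qed.

Section InnerProduct.
Context {R : realType} {X : normedModType R} (J S : X -> topdual X).
Hypothesis JP : duality_map J.
Hypothesis SL : forall a x y, S (a *: x + y) = a *: S x + S y.
Hypothesis JS : forall w, w != 0 -> exists2 c, c != 0 & J w = c *: S w.
Implicit Types (x y w : X) (a : R).

Let Jxx x : J x x = `|x|. Proof. by have [+ _ _] := JP; exact. Qed.
Let Jle x u : J x u <= `|u|.
Proof. by have [_ + _] := JP => /(_ x u); apply: le_trans; exact: ler_norm. Qed.

Let S0 : S 0 = 0.
Proof.
have := SL 1 0 0; rewrite !scale1r addr0 => E.
by apply: (addrI (S 0)); rewrite addr0.
Qed.

Let SZ a x : S (a *: x) = a *: S x.
Proof. by have := SL a x 0; rewrite !addr0 S0 addr0. Qed.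

Let SD x y : S (x + y) = S x + S y.
Proof. by have := SL 1 x y; rewrite !scale1r. Qed.

Let SE := (SD, SZ, @topdualE R X).

Let Sxx w : w != 0 -> S w w != 0.
Proof.
move=> w0; have [c c0 JE] := JS w0; apply/eqP => Sw.
have := Jxx w; rewrite JE topdualE Sw mulr0 => /eqP.
by rewrite eq_sym normr_eq0 (negbTE w0).
Qed.

Let JSE w y : w != 0 -> J w y = `|w| * S w y / S w w.
Proof.
move=> w0; have [c c0 JE] := JS w0.
by rewrite -Jxx JE !topdualE; field; exact: Sxx.
Qed.

(* Along [w(t) = x + t (y - x)] the derivative of [|w|^2 / S w w] is
   [|w|^2 (S x y - S y x) / (S w w)^2]. *)
Let ratio_le x y : indep x y -> S y x <= S x y ->
  `|x| ^+ 2 / S x x <= `|y| ^+ 2 / S y y.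
Proof.
move=> xy om.
have [d dE] : exists d, d = y - x by exists (y - x).
pose w t := x + t *: d.
have w0 t : w t != 0.
  apply/eqP => wt; have [E1 E2] : 1 - t = 0 /\ t = 0; last by lra.
  apply: xy; rewrite -wt /w dE scalerBl scale1r scalerBr.
  by rewrite addrAC addrA.
pose N t := `|w t|; pose q t := S (w t) (w t); pose n t := S (w t) d.
have qE t : q t = S x x + t * (S x d + S d x) + t * t * S d d.
  by rewrite /q /w !SE; ring.
have nE t : n t = S x d + t * S d d by rewrite /n /w !SE; ring.
pose D t := N t * n t / q t.
have q0 t : q t != 0 by exact: Sxx.
have dq (t : R) : is_derive t 1 q ((S x d + S d x) + (t + t) * S d d).
  apply/is_derive1_caratheodory.
  exists (fun z => (S x d + S d x) + (z + t) * S d d); split=> //.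
    by move=> z; rewrite !qE; ring.
  apply: cvgD; first exact: cvg_cst.
  by apply: cvgMl; apply: cvgD; [exact: cvg_id|exact: cvg_cst].
have dn (t : R) : is_derive t 1 n (S d d).
  apply/is_derive1_caratheodory; exists (cst (S d d)); split=> //.
    by move=> z; rewrite !nE /cst; ring.
  exact: cvg_cst.
have cN (t : R) : {for t, continuous N}.
  apply: (@continuous_comp _ _ _ w (fun z : X => `|z|)); last exact: norm_continuous.
  by apply: cvgD; [exact: cvg_cst|apply: cvgZl; exact: cvg_id].
have cder (f : R -> R) (t df : R) : is_derive t 1 f df -> {for t, continuous f}.
  by move=> [/derivable1_diffP + _]; exact: differentiable_continuous.
(* [D r = J (w r) d] is a subgradient of [N], as [J (w r)] is bounded by the norm and attains it at
   [w r]. *)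
have dN (t : R) : is_derive t 1 N (D t).
  apply: is_derive_subgradient => [s r|].
    have -> : D r = J (w r) d by rewrite JSE.
    rewrite /N lerBrDr -[X in _ + X]Jxx.
    have -> : J (w r) d * (s - r) + J (w r) (w r) = J (w r) (w s).
      by rewrite /w !topdualE; ring.
    exact: Jle.
  apply: cvgM; first by apply: cvgM; [exact: cN|exact: cder (dn t)].
  by apply: cvgV; [exact: q0|exact: cder (dq t)].
pose F t := N t * N t / q t.
have dF (t : R) : is_derive t 1 F (N t * N t * (S x y - S y x) / (q t * q t)).
  have dV := is_deriveV (q0 t) (dq t).
  rewrite (_ : F = N * N * (fun z => (q z)^-1)); last by [].
  have dNt := dN t.
  have scE (a b : R) : a *: b = a * b by [].
  have omE : S x y - S y x = S x d - S d x.
    by rewrite dE -(scaleN1r x) !SE; ring.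
  apply: is_derive_eq; rewrite !scE omE.
  have -> : (N * N) t = N t * N t by [].
  by rewrite /D nE; move: (q0 t); set qt := q t => qt0; field.
have : F 0 <= F 1.
  apply: (@ger0_derive1_ndecr _ F 0 1) => //.
  - move=> t _; rewrite derive1E; have [_ ->] := dF t.
    by rewrite -!expr2 mulr_ge0 ?invr_ge0 ?sqr_ge0// mulr_ge0 ?sqr_ge0// subr_ge0.
  - by apply: derivable_within_continuous => t _; have [] := dF t.
by rewrite /F /N /q /w scale0r addr0 scale1r dE addrC subrK -!expr2.
Qed.

Let ratioZ a x : a != 0 -> x != 0 ->
  `|a *: x| ^+ 2 / S (a *: x) (a *: x) = `|x| ^+ 2 / S x x.
Proof.
move=> a0 x0; rewrite SZ !topdualE normrZ exprMn real_normK ?num_real//.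
by field; rewrite a0 Sxx.
Qed.

Let ratioE x y : x != 0 -> y != 0 -> `|x| ^+ 2 / S x x = `|y| ^+ 2 / S y y.
Proof.
move=> x0 y0; have [xy|/(not_indep x0)[a yE]] := pselect (indep x y); last first.
  have a0 : a != 0 by apply/eqP => a0; rewrite yE a0 scale0r eqxx in y0.
  by rewrite yE ratioZ.
wlog om : x y x0 y0 xy / S y x <= S x y.
  move=> H; have [om|om] := leP (S y x) (S x y); first exact: H.
  apply/esym/H => //; last exact: ltW.
  by move=> a b ab; have [] := xy b a; rewrite 1?addrC.
apply/eqP; rewrite eq_le ratio_le//=.
(* The pair [y], [- x] satisfies the same sign condition, and [- x] has the ratio of [x]. *)
rewrite -(@ratioZ (-1) x) ?oppr_eq0 ?oner_eq0//; apply: ratio_le.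
  move=> a b; rewrite scalerA => ab; have [] := xy (b * -1) a.
    by rewrite addrC.
  by move=> bE ->; split=> //; lra.
by rewrite SZ !topdualE; lra.
Qed.

Lemma quadratic_norm : exists k, forall x, `|x| ^+ 2 = k * S x x.
Proof.
have [[w w0]|nw] := pselect (exists w : X, w != 0); last first.
  exists 0 => x; have [->|x0] := eqVneq x 0; first by rewrite normr0 expr0n mul0r.
  by exfalso; apply: nw; exists x.
exists (`|w| ^+ 2 / S w w) => x; have [->|x0] := eqVneq x 0.
  by rewrite normr0 expr0n topdual0 mulr0.
by rewrite (ratioE w0 x0) divfK ?Sxx.
Qed.

(** Only the diagonal of [S] is tied to the norm, so the form is symmetrised. *)
Lemma linear_duality_dot :
  exists d : {dot X for @idfun R}, forall x, `|x| = Num.sqrt (d x x).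
Proof.
have [k kE] := quadratic_norm.
have [|||d dE] := @symmetric_form_dot R X (fun x y => k / 2 * (S x y + S y x)).
- by move=> y a x z /=; rewrite !SE; ring.
- by move=> x y; rewrite [S x y + _]addrC.
- move=> x x0 /=; have -> : k / 2 * (S x x + S x x) = k * S x x by lra.
  by rewrite -kE exprn_gt0// normr_gt0.
exists d => x; rewrite dE; have -> : k / 2 * (S x x + S x x) = k * S x x by lra.
by rewrite -kE sqrtr_sqr normr_id.
Qed.

End InnerProduct.

(** * Poles from best coapproximations *)

(** Two linear equations in the three coefficients over an independent triple. *)
Lemma common_kernel {R : realType} {X : normedModType R} :
  dim_ge X 3 -> forall g1 g2 : topdual X, exists2 u, u != 0 & g1 u = 0 /\ g2 u = 0.
Proof.
move=> [e ind] g1 g2.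
pose A : 'M[R]_(3, 2) := \matrix_(i, j) (if j == 0 then g1 (e i) else g2 (e i)).
pose c := nz_row (kermx A).
have c0 : c != 0.
  rewrite nz_row_eq0 kermx_eq0 /row_free; apply/eqP => rA.
  by have := rank_leq_col A; rewrite rA.
have cA : c *m A = 0 by apply/sub_kermxP; exact: nz_row_sub.
pose u := \sum_(i < 3) c 0 i *: e i.
have gu (g : topdual X) : g u = \sum_(i < 3) c 0 i * g (e i).
  rewrite (big_morph g (topdualD g) (topdual0 g)).
  by apply: eq_bigr => i _; rewrite topdualZ.
exists u.
  apply/eqP => /ind ci; move/eqP: c0; apply; apply/rowP => i.
  by rewrite ci mxE.
split; rewrite gu.
  transitivity ((c *m A) 0 0); last by rewrite cA mxE.
  by rewrite mxE; apply: eq_bigr => i _; rewrite mxE.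
transitivity ((c *m A) 0 1); last by rewrite cA mxE.
by rewrite mxE; apply: eq_bigr => i _; rewrite mxE.
Qed.

Lemma submod_closed_set {R : realType} {X : normedModType R} (Y : set X) :
  submod_closed (mem Y) <->
  Y 0 /\ forall a u v, Y u -> Y v -> Y (a *: u + v).
Proof.
split=> [[Y0 YL]|[Y0 YL]]; split.
- exact: set_mem.
- by move=> a u v Yu Yv; apply: set_mem; apply: YL; exact: mem_set.
- exact: mem_set.
- by move=> a u v /set_mem Yu /set_mem Yv; apply: mem_set; exact: YL.
Qed.

Lemma kernel_hyperspace {R : realType} {X : normedModType R} (g : topdual X) :
  g != 0 -> hyperspace [set y | g y = 0] /\ closed [set y | g y = 0].
Proof.
move=> /topdual_neq0[z gz]; split.
  split.
    apply/submod_closed_set; split; first exact: topdual0.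
    by move=> a u v /= gu gv; rewrite !topdualE gu gv; ring.
  exists z; split=> [/eqP|x]; first by rewrite (negbTE gz).
  by exists (g x / g z); rewrite /= !topdualE; field.
apply: (@preimage_closed _ _ g [set 0]); last exact: closed_eq.
by move=> x _; have [_] := topdual_dual g; exact.
Qed.

(* The projection [P] onto [ker g] along a best coapproximation defect has
   norm one, so [J w \o P] supports the unit ball at [w] and equals [J w]. *)
Lemma coproximinal_pole {R : realType} {X : normedModType R} (J : X -> topdual X)
    (g : topdual X) : duality_map J -> J 0 = 0 -> g != 0 ->
  ~ anti_coproximinal [set y | g y = 0] -> exists v, g v = 1 /\ pole J g v.
Proof.
move=> [Jxx Jle Juniq] J0 g0 /existsNP[x /not_implyP[/eqP gx /contrapT[y0 [gy0 ya]]]].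
rewrite /= in gy0 ya.
pose v := (g x)^-1 *: (x - y0).
have gv : g v = 1 by rewrite /v !topdualE gy0 subr0 mulVf.
have vle w s : g w = 0 -> `|w| <= `|w + s *: v|.
  move=> gw; have [->|s0] := eqVneq s 0; first by rewrite scale0r addr0.
  pose r := s / g x.
  have r0 : r != 0 by rewrite mulf_neq0// invr_eq0.
  (* At this test point the inequality is the claim scaled by [r^-1], since
     [r^-1 * s *: v = x - y0]. *)
  have := ya (y0 - r^-1 *: w); rewrite !topdualE gy0 gw mulr0 subr0 => /(_ erefl).
  rewrite subKr opprB addrCA addrC => le.
  rewrite -(@ler_pM2l _ `|r^-1|) ?normr_gt0 ?invr_eq0// -!normrZ.
  suff -> : r^-1 *: (w + s *: v) = x - y0 + r^-1 *: w by [].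
  rewrite scalerDr /v !scalerA addrC; congr (_ + _).
  have -> : r^-1 * s * (g x)^-1 = 1 by rewrite /r; field; rewrite gx s0.
  by rewrite scale1r.
clearbody v; exists v; split=> // w gw.
have [->|w0] := eqVneq w 0; first by rewrite J0 topdual_f0.
suff E : J w - J w v *: g = J w.
  by rewrite -E !topdualE gv; ring.
apply: Juniq => //; last by rewrite !topdualE gw mulr0 subr0.
move=> u; have -> : (J w - J w v *: g) u = J w (u - g u *: v).
  by rewrite !topdualE; ring.
apply: le_trans (Jle _ _) _.
have := vle (u - g u *: v) (g u); rewrite subrK; apply.
by rewrite !topdualE gv; ring.
Qed.

(** * Orthogonal projection onto a closed hyperspace *)

Section Projection.
Context {R : realType} {X : completeNormedModType R} (d : {dot X for @idfun R}).
Hypothesis dE : forall x : X, `|x| = Num.sqrt (d x x).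
Implicit Types (x y u v w : X) (a : R).

Let dDl a x y z : d (a *: x + y) z = a * d x z + d y z.
Proof. exact: (linearPl d). Qed.

Let dC x y : d x y = d y x.
Proof. by rewrite (@hermitian_subproof _ _ _ _ d) expr0 mul1r. Qed.

Let dDr a x y z : d z (a *: x + y) = a * d z x + d z y.
Proof. by rewrite dC dDl !(dC z). Qed.

Let norm2 x : `|x| ^+ 2 = d x x.
Proof.
have d00 : d 0 0 = 0.
  by have := dDl (-1) 0 0 0; rewrite scaler0 addr0 mulN1r addNr.
rewrite dE sqr_sqrtr//; have [->|x0] := eqVneq x 0; first by rewrite d00.
by rewrite ltW// neq0_dnorm_gt0.
Qed.

Let norm2DZ a u v : `|u + a *: v| ^+ 2 =
  `|u| ^+ 2 + 2 * a * d u v + a ^+ 2 * `|v| ^+ 2.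
Proof. by rewrite !norm2 addrC dDl !dDr (dC v u); ring. Qed.

Let parallelogram u v :
  `|u - v| ^+ 2 = 2 * `|u| ^+ 2 + 2 * `|v| ^+ 2 - 4 * `|2^-1 *: (u + v)| ^+ 2.
Proof.
rewrite normrZ exprMn ger0_norm ?invr_ge0// -[v in u - v]scale1r -scaleNr norm2DZ.
by rewrite -[v in u + v]scale1r norm2DZ; field.
Qed.

(** Midpoints stay in [Y], so the parallelogram law makes a minimising sequence Cauchy. *)
Lemma closed_nearest_point (Y : set X) z : closed Y -> Y 0 ->
  (forall a u v, Y u -> Y v -> Y (a *: u + v)) ->
  exists2 m, Y m & forall y, Y y -> `|z - m| ^+ 2 <= `|z - y| ^+ 2.
Proof.
move=> clY Y0 YL.
pose E := [set `|z - y| ^+ 2 | y in Y].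
have lbE : has_lbound E by exists 0 => _ [y _ <-]; exact: sqr_ge0.
have infE : has_inf E by split=> //; exists (`|z - 0| ^+ 2); exists 0.
have I_le y : Y y -> inf E <= `|z - y| ^+ 2 by move=> Yy; apply: ge_inf => //; exists y.
have /choice[u uP] : forall n : nat,
    exists y, Y y /\ `|z - y| ^+ 2 < inf E + n.+1%:R^-1.
  move=> n; have e0 : 0 < n.+1%:R^-1 :> R by rewrite invr_gt0 ltr0n.
  by have [_ [y Yy <-] ylt] := inf_adherent e0 infE; exists y.
have Yu n : Y (u n) by have [] := uP n.
have ult n : `|z - u n| ^+ 2 < inf E + n.+1%:R^-1 by have [] := uP n.
have dist n p : `|u n - u p| ^+ 2 <= 2 * n.+1%:R^-1 + 2 * p.+1%:R^-1.
  have -> : u n - u p = (z - u p) - (z - u n) by rewrite opprB [RHS]addrC addrA subrK.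
  rewrite parallelogram.
  have -> : 2^-1 *: (z - u p + (z - u n)) = z - (2^-1 *: u p + 2^-1 *: u n).
    rewrite addrACA -opprD scalerBr -scalerDr; congr (_ - _).
    by rewrite -mulr2n -(scaler_nat 2 z) scalerA mulVf ?scale1r.
  have := I_le (2^-1 *: u p + 2^-1 *: u n).
  have Ym : Y (2^-1 *: u p + 2^-1 *: u n).
    by apply: (YL _ _ _ (Yu p)); rewrite -[_ *: u n]addr0; exact: YL.
  move=> /(_ Ym); move: (ult n) (ult p).
  by move: n.+1%:R^-1 p.+1%:R^-1 => a b; lra.
have inv_lt (e : R) : 0 < e -> exists N : nat, forall n, (N <= n)%N -> n.+1%:R^-1 < e.
  move=> e0; exists (Num.Def.archi_bound e^-1) => n Nn.
  rewrite -[e]invrK ltf_pV2 ?posrE ?invr_gt0 ?ltr0n//.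
  apply: lt_le_trans (archi_boundP _) _; first by rewrite invr_ge0 ltW.
  by rewrite ler_nat leqW.
have cu : cvg (u @ \oo).
  apply/cauchy_cvgP/cauchy_exP => e e0.
  have [N NP] := inv_lt (e ^+ 2 / 4) (divr_gt0 (exprn_gt0 2 e0) (ltr0n _ 4)).
  exists (u N), N => // n /= Nn.
  rewrite -ball_normE /= -(@ltr_pXn2r _ 2)// ?nnegrE// ?(ltW e0)//.
  have := dist N n; have := NP _ (leqnn N); have := NP _ Nn.
  by move: n.+1%:R^-1 N.+1%:R^-1 => a b; lra.
have Ylim : Y (lim (u @ \oo)).
  by apply: (closed_cvg Y clY _ _ cu); exact: nearW.
exists (lim (u @ \oo)) => // y Yy.
apply: le_trans (I_le _ Yy); apply/ler_addgt0Pr => e e0.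
have cn : `|z - u n| ^+ 2 @[n --> \oo] --> `|z - lim (u @ \oo)| ^+ 2.
  rewrite expr2; under eq_fun do rewrite expr2.
  by apply: cvgM; apply: cvg_norm; apply: cvgB => //; exact: cvg_cst.
apply: (closed_cvg [set r | r <= inf E + e] (@closed_le _ _) _ _ cn).
have [N NP] := inv_lt _ e0; exists N => // n /= Nn.
have := ult n; have := NP _ Nn.
by rewrite /=; move: n.+1%:R^-1 => a; lra.
Qed.

(** For the nearest point [m], [z - m] is orthogonal to [Y]; Pythagoras bounds [|m - y|] by
    [|z - y|]. *)
Lemma closed_hyperspace_coproximinal (Y : set X) :
  hyperspace Y -> closed Y -> ~ anti_coproximinal Y.
Proof.
move=> [/submod_closed_set[Y0 YL] [z [nYz _]]] clY anti.
have [m Ym mP] := closed_nearest_point z clY Y0 YL.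
apply: (anti z nYz); exists m; split=> // y Yy.
pose v := z - m; pose w := m - y.
have Yw : Y w by rewrite /w addrC -scaleN1r; exact: YL.
have orth : d v w = 0.
  have [->|w0] := eqVneq w 0.
    by have := dDr (-1) 0 0 v; rewrite scaler0 addr0 mulN1r addNr.
  have dw : 0 < d w w by exact: neq0_dnorm_gt0.
  (* The minimiser of [|v + t *: w|]. *)
  pose t := - (d v w / d w w).
  have := mP (- t *: w + m) (YL _ _ _ Yw Ym).
  have -> : z - (- t *: w + m) = v + t *: w.
    by rewrite /v scaleNr opprD opprK addrA addrAC.
  rewrite norm2DZ (norm2 w).
  have -> : `|v| ^+ 2 + 2 * t * d v w + t ^+ 2 * d w w =
      `|v| ^+ 2 - d v w ^+ 2 / d w w.
    by rewrite /t; field; rewrite gt_eqF.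
  have : 0 <= d v w ^+ 2 / d w w by rewrite divr_ge0 ?sqr_ge0// ltW.
  rewrite -/v => ge0 le.
  have /eqP : d v w ^+ 2 / d w w = 0 by lra.
  by rewrite mulf_eq0 invr_eq0 (gt_eqF dw) orbF sqrf_eq0 => /eqP.
rewrite -(@ler_pXn2r _ 2)// ?nnegrE//.
have -> : z - y = v + 1 *: w by rewrite scale1r /v /w addrA subrK.
by rewrite norm2DZ orth -/w; have := sqr_ge0 `|v|; lra.
Qed.

End Projection.

(** * Hilbert spaces and anti-coproximinal closed hyperspaces *)

Theorem theorem2p11 (R : realType) (X : completeNormedModType R)
    (dimX : dim_ge X 3) (smoothX : smooth X) :
  hilbert X <->
  ~ exists Y : set X, [/\ hyperspace Y, closed Y & anti_coproximinal Y].
Proof.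
split=> [[d dE] [Y [hY cY aY]]|noY].
  exact: (closed_hyperspace_coproximinal dE hY cY).
have [J [JP J0]] := smooth_duality_map smoothX.
have poleP (g : topdual X) : g != 0 -> exists v, g v = 1 /\ pole J g v.
  move=> g0; have [hY cY] := kernel_hyperspace g0.
  apply: coproximinal_pole => // aY; apply: noY.
  by exists [set y | g y = 0].
have dim3 := common_kernel dimX.
have [w w0 _] := dim3 0 0.
have [S [SL JS]] := linear_duality JP poleP dim3 (ex_intro _ w w0).
exact: linear_duality_dot JP SL JS.
Qed.
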